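(* Assume that the kernels satisfy $0\le k^j(x,x')\le K^j$ for all $x,x'\in\mathbb X^j$ and $j\in[d]$, and let $K_0:=\prod_{j=1}^dK^j$. Then, for some constant $C>0$ and all $t>0$, $$\mathbb P_{\boldsymbol\pi}\big(U_{\boldsymbol\pi,\mathrm{dHSIC}}\ge t\mid\mathcal X_n\big)\le\exp\Big\{-C\min\Big(\frac{n^2t^2}{K_0^2},\frac{nt}{K_0}\Big)\Big\},$$ where $U_{\boldsymbol\pi,\mathrm{dHSIC}}$ is the permuted U-statistic of dHSIC defined in the context.
   Context: Superscripts on $k$, $K$, $X$, $\pi$ are indices, not exponents. $d\ge2$ is fixed, and the constant $C$ does not depend on $n$, $t$ or the data. For each $j\in[d]=\{1,\dots,d\}$, $\mathbb X^j$ is a separable topological space and $k^j:\mathbb X^j\times\mathbb X^j\to\mathbb R$ is a continuous, bounded, positive semi-definite kernel; the product kernel $\prod_jk^j$ is assumed characteristic. $\mathcal X_n=(\mathbf X_1,\dots,\mathbf X_n)$ with $\mathbf X_i=(X_i^1,\dots,X_i^d)\in\mathbb X^1\times\dots\times\mathbb X^d$. $\mathbf i_q^n$ is the set of $q$-tuples drawn without replacement from $[n]$; $n$ is large enough for the index sets below to be non-empty ($n\ge2d$). $\boldsymbol\pi=(\pi^1,\dots,\pi^d)$ is a $d$-tuple of permutations of $[n]$, $\pi^l=(\pi_1^l,\dots,\pi_n^l)$, drawn uniformly at random and independently of $\mathcal X_n$; $\mathbb P_{\boldsymbol\pi}(\cdot\mid\mathcal X_n)$ is the probability over $\boldsymbol\pi$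 with the data fixed. $$U_{\boldsymbol\pi,\mathrm{dHSIC}}=\frac{(n-2)!}{n!}\sum_{(i,j)\in\mathbf i_2^n}\prod_{l=1}^dk^l(X^l_{\pi_i^l},X^l_{\pi_j^l})+\frac{(n-2d)!}{n!}\sum_{(i_1,j_1,\dots,i_d,j_d)\in\mathbf i_{2d}^n}\prod_{l=1}^dk^l(X^l_{\pi^l_{i_l}},X^l_{\pi^l_{j_l}})-\frac{2(n-d-1)!}{n!}\sum_{(i,j_1,\dots,j_d)\in\mathbf i_{d+1}^n}\prod_{l=1}^dk^l(X^l_{\pi^l_i},X^l_{\pi^l_{j_l}}).$$ *)

(* Defs.v *)
From HB Require Import structures.
From mathcomp Require Import all_boot all_order all_algebra all_fingroup.
From mathcomp Require Import all_classical all_reals all_analysis.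
Set Implicit Arguments.
Unset Strict Implicit.
Unset Printing Implicit Defensive.
Import Order.TTheory GRing.Theory Num.Theory.
Import numFieldNormedType.Exports.
Local Open Scope classical_set_scope.
Local Open Scope ring_scope.

Definition separable_space (T : topologicalType) : Prop :=
  exists D : set T, countable D /\ dense D.

Section Kernels.
Variables (R : realType) (T : ptopologicalType).
Implicit Types k : T -> T -> R.

(* As usual for kernels, positive semi-definiteness includes symmetry. *)
Definition psd_kernel k : Prop :=
  (forall x y, k x y = k y x) /\
  (forall (m : nat) (x : 'I_m -> T) (a : 'I_m -> R),
     0 <= \sum_(i < m) \sum_(j < m) a i * a j * k (x i) (x j)).

Definition continuous_kernel k : Prop :=
  continuous (fun p : T * T => k p.1 p.2).

Definition bounded_kernel k : Prop :=
  exists M : R, forall x y, `|k x y| <= M.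

Definition borel : measurableType _ := g_sigma_algebraType (@open T).

(* The mean embedding int k(x, .) dP(x) is an element of the RKHS of k, which
   is a space of functions on T; here it is given by its values. *)
Definition mean_embedding k (P : probability borel R) (y : T) : R :=
  (\int[P]_x k x y)%R.

Definition characteristic_kernel k : Prop :=
  forall P Q : probability borel R,
    mean_embedding k P = mean_embedding k Q ->
    forall A : set borel, measurable A -> P A = Q A.

End Kernels.

HB.instance Definition _ (I : Type) (T : I -> ptopologicalType) :=
  isPointed.Build (prod_topology T) (fun=> point).

(* The Borel sets used by [characteristic_kernel (product_kernel k)] are those of the
   product topology. *)
Definition product_kernel (R : realType) (d : nat) (T : 'I_d -> ptopologicalType)
    (k : forall l, T l -> T l -> R) (x y : prod_topology T) : R :=
  \prod_(l < d) k l (x l) (y l).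

Section PermutedStatistic.
Variables (R : realType) (d n : nat) (T : 'I_d -> ptopologicalType).
Variables (k : forall l, T l -> T l -> R) (X : 'I_n -> forall l, T l).

Definition permuted_gram (pi : {ffun 'I_d -> 'S_n}) (l : 'I_d) (i j : 'I_n) : R :=
  k (X (pi l i) l) (X (pi l j) l).

(* Sampling q indices without replacement is the condition [uniq] on the
   sequence of the q indices.  In the second sum that sequence is listed as
   (i_1, ..., i_d, j_1, ..., j_d) instead of (i_1, j_1, ..., i_d, j_d). *)
Definition U_dHSIC (pi : {ffun 'I_d -> 'S_n}) : R :=
  ((n - 2)`!)%:R / (n`!)%:R *
    (\sum_(i < n) \sum_(j < n | uniq [:: i; j])
       \prod_(l < d) permuted_gram pi l i j)
  + ((n - 2 * d)`!)%:R / (n`!)%:R *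
    (\sum_(i : d.-tuple 'I_n) \sum_(j : d.-tuple 'I_n | uniq (i ++ j))
       \prod_(l < d) permuted_gram pi l (tnth i l) (tnth j l))
  - (2 * (n - d - 1)`!)%:R / (n`!)%:R *
    (\sum_(i < n) \sum_(j : d.-tuple 'I_n | uniq (i :: j))
       \prod_(l < d) permuted_gram pi l i (tnth j l)).

End PermutedStatistic.

(* Probability of the event A when pi is uniform on the d-tuples of permutations
   of [n] (equivalently, its d components are independent and uniform). *)
Definition perm_prob (R : realType) (d n : nat)
    (A : {ffun 'I_d -> 'S_n} -> bool) : R :=
  #|[pred pi | A pi]|%:R / #|{ffun 'I_d -> 'S_n}|%:R.

(* Main.v *)
Require Import Defs.
From mathcomp Require Import all_boot all_order all_algebra all_fingroup.
From mathcomp Require Import all_classical all_reals all_analysis.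
From mathcomp Require Import primitive_action alt.
From mathcomp Require Import ring lra.
Import Order.TTheory GRing.Theory Num.Theory.
Import numFieldNormedType.Exports.
Local Open Scope ring_scope.
Set Implicit Arguments.
Unset Strict Implicit.
Unset Printing Implicit Defensive.

(** The bound is a Chernoff bound, so everything rests on an estimate of the
   moment generating function (MGF) of the statistic U under random
   permutations ([mgf_U_dHSIC]).

   Write phi^l for the feature map of k^l, so that the product kernel is the
   scalar product of tensors, and attach to a tuple p of d positions the tensor
   psi(p) = phi^1(p_z) (x) ... (x) phi^d(p_z) - phi^1(p_1) (x) ... (x) phi^d(p_d),
   where z is a fixed slot.  [block_kernel] is <psi(p), psi(q)> expanded into four
   products of Gram entries.  U is the average of <psi(p), psi(q)> over all pairs
   of disjoint injective tuples, so for a fixed pair (p, q) it is the average of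
   <psi(s p), psi(s q)> over the permutations s of the n positions
   ([U_dHSIC_avg]).  Hence U is also such an average of the normalised double sum
   m^-2 sum_(a, b) <psi(p_a), psi(q_b)> over 2m disjoint blocks p_a, q_b of d
   positions, with m = n / 2d rounded down.  By convexity of exp, and because
   composing pi with s preserves the uniform law, the MGF of U is at most the MGF
   of that double sum.

   The double sum is a decoupled degenerate chaos: the uniform law of pi is also
   preserved by permuting, independently for each block and each coordinate l,
   the d slots of the block ([avg_slots]), and the average of psi over these
   shuffles vanishes, since both of its terms average to the tensor product of
   the block means ([block_kernel_centered]).  So, given pi, the double sum is
   sum_(a, b) h_ab(g_a, g'_b) with independent g_a, g'_b, each h_ab centered in
   each argument and bounded by c = 2 K_0.  Its MGF is bounded by elementary
   means ([mgf_decoupled_chaos]): exp x <= x + exp(2 x^2) removes the linear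
   term in the g_a and leaves squares of sums of independent centered variables
   in the g'_b, whose exponential moments are controlled up to a threshold
   ([mgf_square_sum]).  The result is a Gaussian MGF bound with variance of order
   K_0^2 / n^2, valid for parameters up to order n / K_0, which is what produces
   the minimum of a quadratic and a linear rate. *)

(** * Averages over finite types *)

Section Averages.
Variable R : realType.

Definition avg (I : finType) (f : I -> R) : R := (\sum_i f i) / #|I|%:R.

Lemma eq_avg (I : finType) (f g : I -> R) : f =1 g -> avg f = avg g.
Proof. by move=> fg; congr (_ / _); apply: eq_bigr => i _. Qed.

Lemma le_avg (I : finType) (f g : I -> R) :
  (forall i, f i <= g i) -> avg f <= avg g.
Proof. by move=> fg; rewrite ler_wpM2r ?invr_ge0 ?ler0n// ler_sum. Qed.

Lemma avgD (I : finType) (f g : I -> R) :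
  avg (fun i => f i + g i) = avg f + avg g.
Proof. by rewrite /avg big_split mulrDl. Qed.

Lemma avgB (I : finType) (f g : I -> R) :
  avg (fun i => f i - g i) = avg f - avg g.
Proof. by rewrite /avg sumrB mulrBl. Qed.

Lemma avgZ (I : finType) (a : R) (f : I -> R) :
  avg (fun i => a * f i) = a * avg f.
Proof. by rewrite /avg -mulr_sumr mulrA. Qed.

Lemma avg_cst (I : finType) (a : R) : (0 < #|I|)%N -> avg (fun _ : I => a) = a.
Proof.
move=> I_gt0; rewrite /avg sumr_const -[a *+ _]mulr_natr mulfK//.
by rewrite pnatr_eq0 -lt0n.
Qed.

Lemma avg_sum (I J : finType) (f : I -> J -> R) :
  avg (fun i => \sum_j f i j) = \sum_j avg (f^~ j).
Proof. by rewrite /avg exchange_big mulr_suml. Qed.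

Lemma exchange_avg (I J : finType) (f : I -> J -> R) :
  avg (fun i => avg (f i)) = avg (fun j => avg (f^~ j)).
Proof.
by rewrite /avg -!mulr_suml exchange_big mulrAC.
Qed.

Lemma avg_reindex (I : finType) (h : I -> I) (f : I -> R) :
  injective h -> avg f = avg (f \o h).
Proof. by move=> h_inj; rewrite /avg (reindex_inj h_inj). Qed.

Lemma avg_prod (I J : finType) (f : I -> J -> R) :
  avg (fun g : {ffun I -> J} => \prod_i f i (g i)) = \prod_i avg (f i).
Proof.
rewrite /avg -(bigA_distr_bigA f) big_split/= card_ffun prodr_const natrX.
by rewrite exprVn.
Qed.

(** Jensen's inequality, from the tangent to exp at the mean. *)
Lemma expR_avg_le (I : finType) (f : I -> R) : (0 < #|I|)%N ->
  expR (avg f) <= avg (fun i => expR (f i)).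
Proof.
move=> I_gt0; set m := avg f.
have : avg (fun i => expR m * (1 - m + f i)) <= avg (fun i => expR (f i)).
  apply: le_avg => i; rewrite -[in leRHS](subrK m (f i)) [leRHS]expRD.
  rewrite mulrC ler_wpM2r ?expR_ge0//.
  by apply: le_trans (expR_ge1Dx _); rewrite -addrA [- m + _]addrC.
by rewrite avgZ avgD avg_cst// -/m subrK mulr1.
Qed.

(** * Exponential moments of centered variables *)

Lemma expR_le_square (x : R) : expR x <= x + expR (2 * x ^+ 2).
Proof.
have sq := expR_ge1Dx (2 * x ^+ 2).
(* Above 1/2 already x <= 2 x^2; below it, exp x <= (1 - x)^-1 and
   (1 - x)^-1 <= 1 + x + 2 x^2. *)
have [x_ge|x_lt] := lerP (2^-1) x.
  have : expR x <= expR (2 * x ^+ 2) by rewrite ler_expR; nra.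
  by move: x_ge; lra.
have x1 : 0 < 1 - x by lra.
have : expR x * (1 - x) <= 1.
  have := expR_ge1Dx (- x); rewrite expRN => h.
  by rewrite -ler_pdivlMl ?expR_gt0// mulr1.
nra.
Qed.

(** Centering removes the first-order term, without any bound on [f]; the
   quadratic term keeps the actual size of [f], which is what the chaos estimate
   below needs. *)
Lemma avg_expR_centered (I : finType) (f : I -> R) : avg f = 0 ->
  avg (fun i => expR (f i)) <= avg (fun i => expR (2 * f i ^+ 2)).
Proof.
move=> f0; rewrite -[leRHS]add0r -[X in X + _]f0 -avgD.
by apply: le_avg => i; apply: expR_le_square.
Qed.

Lemma sqr_le (x c : R) : `|x| <= c -> x ^+ 2 <= c ^+ 2.
Proof. by rewrite ler_norml => /andP[? ?]; nra. Qed.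

Lemma avg_expR_bounded (I : finType) (f : I -> R) (c s : R) :
  (0 < #|I|)%N -> avg f = 0 -> (forall i, `|f i| <= c) ->
  avg (fun i => expR (s * f i)) <= expR (2 * (s * c) ^+ 2).
Proof.
move=> I_gt0 f0 fc.
have /le_trans-> // : avg (fun i => expR (s * f i)) <=
    avg (fun i => expR (2 * (s * f i) ^+ 2)).
  by apply: avg_expR_centered; rewrite avgZ f0 mulr0.
rewrite -[leRHS](avg_cst _ I_gt0); apply: le_avg => i.
rewrite ler_expR !exprMn; do 2!apply: ler_wpM2l => //; first exact: sqr_ge0.
exact: sqr_le.
Qed.

Definition update (J G : finType) (g : {ffun J -> G}) (j : J) (x : G) :=
  [ffun i => if i == j then x else g i].

(** Redrawing one coordinate of a uniform function leaves it uniform: on pairs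
   (g, x), exchanging x with the value of g at j is an involution. *)
Lemma avg_resample (J G : finType) (j : J) (F : {ffun J -> G} -> R) :
  (0 < #|G|)%N -> avg F = avg (fun g => avg (fun x => F (update g j x))).
Proof.
move=> G_gt0.
have -> : avg F = avg (fun g : {ffun J -> G} => avg (fun x : G => F g)).
  by apply: eq_avg => g; rewrite avg_cst.
rewrite /avg -!mulr_suml !pair_bigA/=; congr (_ / _ / _).
pose h (p : {ffun J -> G} * G) := (update p.1 j p.2, p.1 j).
have h_inv : involutive h.
  move=> [g x]; rewrite /h/= ffunE eqxx; congr (_, _).
  by apply/ffunP => i; rewrite !ffunE; case: eqP => // ->.
by rewrite (reindex_inj (inv_inj h_inv)).
Qed.

(** Exponential moments of the square of a sum S of independent centered
   variables bounded by c.  Integrating out one summand X in exp(t (X + S)^2)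
   costs a factor exp(t c^2) and changes t S^2 into (t + 8 t^2 c^2) S^2.  With
   t = 1/y this is (y + 8 c^2)/y^2 <= 1/(y - 8 c^2), so each summand that is
   removed lowers the denominator by 8 c^2; the denominator is shaped
   accordingly, and it stays at least b. *)
Lemma mgf_square_sum (J G : finType) (f : J -> G -> R) (c b : R) (r : seq J) :
  (0 < #|G|)%N -> (forall j, avg (f j) = 0) -> (forall j x, `|f j x| <= c) ->
  0 < b -> uniq r ->
  avg (fun g : {ffun J -> G} =>
    expR ((\sum_(j <- r) f j (g j)) ^+ 2 / (b + 8 * (size r)%:R * c ^+ 2)))
  <= expR ((size r)%:R * c ^+ 2 / b).
Proof.
move=> G_gt0 f0 fc b_gt0.
have ffun_gt0 : (0 < #|{ffun J -> G}|)%N by rewrite card_ffun expn_gt0 G_gt0.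
have c2 := sqr_ge0 c.
elim: r => [_|j r IH /= /andP[jr ur]].
  under eq_avg do rewrite big_nil expr0n mul0r expR0.
  by rewrite avg_cst// !mul0r expR0.
rewrite (avg_resample j)//.
have s0 : 0 <= (size r)%:R * c ^+ 2 by rewrite mulr_ge0.
set y := b + 8 * (size r)%:R * c ^+ 2.
have y_gt0 : 0 < y by rewrite /y -mulrA; lra.
set z := b + _.
have zE : z = y + 8 * c ^+ 2 by rewrite /z /y -natr1; ring.
have z_gt0 : 0 < z by lra.
suff step g : avg (fun x => expR
      ((\sum_(i <- j :: r) f i (update g j x i)) ^+ 2 / z))
    <= expR (c ^+ 2 / b) * expR ((\sum_(i <- r) f i (g i)) ^+ 2 / y).
  apply: le_trans (le_avg step) _; rewrite avgZ -natr1 mulrDl mul1r mulrDl.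
  by rewrite addrC expRD ler_wpM2l ?expR_ge0 ?IH.
set S := \sum_(i <- r) f i (g i).
have SE x : \sum_(i <- j :: r) f i (update g j x i) = f j x + S.
  rewrite big_cons ffunE eqxx; congr (_ + _).
  apply: eq_big_seq => i ir; rewrite ffunE; case: eqP => // ij.
  by rewrite -ij ir in jr.
under eq_avg do rewrite SE.
apply: (@le_trans _ _ (avg (fun x =>
    expR ((S ^+ 2 + c ^+ 2) / z) * expR (2 * S / z * f j x)))).
  apply: le_avg => x; rewrite -expRD ler_expR.
  rewrite [2 * S / z * _]mulrAC -mulrDl ler_pM2r ?invr_gt0//.
  suff : f j x ^+ 2 <= c ^+ 2 by lra.
  exact: sqr_le.
rewrite avgZ.
apply: (le_trans (ler_wpM2l (expR_ge0 _)
  (avg_expR_bounded (2 * S / z) G_gt0 (f0 j) (fc j)))).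
rewrite -!expRD ler_expR.
have bz : c ^+ 2 / z <= c ^+ 2 / b.
  by rewrite ler_wpM2l// lef_pV2 ?posrE// zE /y -mulrA; lra.
suff : S ^+ 2 / z + 2 * (2 * S / z * c) ^+ 2 <= S ^+ 2 / y.
  by move: bz; rewrite mulrDl; lra.
have -> : S ^+ 2 / z + 2 * (2 * S / z * c) ^+ 2 =
    S ^+ 2 * ((z + 8 * c ^+ 2) / z ^+ 2) by field; lra.
apply: ler_wpM2l; first exact: sqr_ge0.
rewrite ler_pdivrMr ?exprn_gt0// -ler_pdivrMl ?invr_gt0// invrK.
by rewrite zE; nra.
Qed.

(** Averaging over g first, the variables sum_j h i j (g i) (g' j) are
   independent and centered given g', so [avg_expR_centered] turns the exponent
   into 2 u^2 times the sum over i of their squares.  Convexity replaces that sum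
   by #|J| times one square, averaged over i, and [mgf_square_sum] applies to each
   square as a function of g'. *)
Lemma mgf_decoupled_chaos (J G G' : finType) (h : J -> J -> G -> G' -> R)
    (c u : R) :
  (0 < #|J|)%N -> (0 < #|G|)%N -> (0 < #|G'|)%N ->
  (forall i j y, avg (fun x => h i j x y) = 0) ->
  (forall i j x, avg (fun y => h i j x y) = 0) ->
  (forall i j x y, `|h i j x y| <= c) ->
  32 * (u * c * #|J|%:R) ^+ 2 <= 1 ->
  avg (fun g : {ffun J -> G} => avg (fun g' : {ffun J -> G'} =>
    expR (u * \sum_i \sum_j h i j (g i) (g' j))))
  <= expR (4 * (u * c * #|J|%:R) ^+ 2).
Proof.
move=> J_gt0 G_gt0 G'_gt0 h0 h0' hc.
set m := #|J|%:R; move=> small.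
have m_gt0 : 0 < m by rewrite ltr0n.
have card0 : (0 < #|{ffun J -> G}|)%N by rewrite card_ffun expn_gt0 G_gt0.
have card0' : (0 < #|{ffun J -> G'}|)%N by rewrite card_ffun expn_gt0 G'_gt0.
pose Y i (g' : {ffun J -> G'}) x : R := \sum_j h i j x (g' j).
rewrite exchange_avg.
apply: (@le_trans _ _ (avg (fun g' : {ffun J -> G'} =>
    avg (fun g : {ffun J -> G} => avg (fun i =>
      expR (2 * m * u ^+ 2 * Y i g' (g i) ^+ 2)))))).
  apply: le_avg => g'.
  have -> : avg (fun g : {ffun J -> G} =>
      expR (u * \sum_i \sum_j h i j (g i) (g' j))) =
      \prod_i avg (fun x => expR (u * Y i g' x)).
    rewrite -(avg_prod (fun i x => expR (u * Y i g' x))).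
    by apply: eq_avg => g; rewrite mulr_sumr expR_sum.
  apply: (@le_trans _ _ (\prod_i avg (fun x =>
      expR (2 * (u * Y i g' x) ^+ 2)))).
    apply: ler_prod => i _; apply/andP; split.
      by rewrite mulr_ge0 ?invr_ge0// sumr_ge0// => x _; apply: expR_ge0.
    by apply: avg_expR_centered; rewrite avgZ /Y avg_sum big1 ?mulr0.
  rewrite -(avg_prod (fun i x => expR (2 * (u * Y i g' x) ^+ 2))).
  apply: le_avg => g; rewrite -expR_sum.
  have -> : \sum_i 2 * (u * Y i g' (g i)) ^+ 2 =
      avg (fun i => 2 * m * u ^+ 2 * Y i g' (g i) ^+ 2).
    rewrite avgZ /avg -/m -mulr_sumr; under eq_bigr do rewrite exprMn.
    by rewrite -mulr_sumr; field; lra.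
  exact: expR_avg_le.
(* Now g and i are fixed, and only g' is averaged. *)
rewrite exchange_avg -[leRHS](avg_cst _ card0).
apply: le_avg => g; rewrite exchange_avg -[leRHS](avg_cst _ J_gt0).
apply: le_avg => i; rewrite /Y.
have [->|u0] := eqVneq u 0.
  under eq_avg do rewrite expr0n mulr0 mul0r expR0.
  by rewrite avg_cst// !mul0r expr0n mulr0 expR0.
have u2 : 0 < u ^+ 2 by rewrite exprn_even_gt0.
set a := 2 * m * u ^+ 2.
have a_gt0 : 0 < a by apply: mulr_gt0 => //; apply: mulr_gt0.
(* This b makes the denominator of the square equal to a^-1; the bound on u
   keeps b above half of a^-1. *)
pose b := a^-1 - 8 * m * c ^+ 2.
have aV : (2 * a)^-1 <= b.
  have -> : b = (2 * a)^-1 + (2 * a)^-1 * (1 - 32 * (u * c * m) ^+ 2).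
    by rewrite /b /a; field; rewrite u0; lra.
  by rewrite lerDl mulr_ge0 ?invr_ge0//; lra.
have b_gt0 : 0 < b by apply: lt_le_trans aV; rewrite invr_gt0; lra.
have := @mgf_square_sum J G' (fun j => h i j (g i)) c b (enum J) G'_gt0
  (fun j => h0' i j (g i)) (fun j => hc i j (g i)) b_gt0 (enum_uniq _).
rewrite -cardE -/m.
under eq_avg do rewrite big_enum/= /b subrK invrK mulrC.
move=> /le_trans; apply; rewrite ler_expR.
have -> : 4 * (u * c * m) ^+ 2 = m * c ^+ 2 * (2 * a) by rewrite /a; ring.
apply: ler_wpM2l; first by rewrite mulr_ge0 ?sqr_ge0// ltW.
by rewrite -[leRHS]invrK lef_pV2 ?posrE// invr_gt0; lra.
Qed.

End Averages.

(** * Sampling without replacement through random permutations *)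

Lemma perm_extend (Q T : finType) (w w' : Q -> T) :
  injective w -> injective w' -> exists s : {perm T}, forall y, s (w y) = w' y.
Proof.
move=> w_inj w'_inj.
have dt (v : Q -> T) : injective v -> codom_tuple v \in dtuple_on #|Q| [set: T].
  move=> v_inj; rewrite inE; apply/andP; split; first exact/injectiveP.
  by apply/fintype.subsetP => x _; rewrite inE.
have [s _ /(congr1 val)/= ws] := atransP2
  (ntransitive_weak (leq_card w w_inj) (Sym_trans T))
  (dt _ w_inj) (dt _ w'_inj).
exists s => y; move: ws.
rewrite /codom /image_mem -map_comp => /esym/eq_in_map/(_ y); apply.
exact: mem_enum.
Qed.

(** A uniform permutation sends a fixed injective tuple to a uniform one: the
   average on the right is the same for all injective t0, because they form a
   single orbit, and averaging it over t0 gives the left-hand side. *)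
Lemma avg_perm_tuple (R : realType) (n q : nat) (t0 : q.-tuple 'I_n)
    (F : q.-tuple 'I_n -> R) : uniq t0 ->
  ((n - q)`!)%:R / (n`!)%:R * (\sum_(t : q.-tuple 'I_n | uniq t) F t) =
  avg (fun s : 'S_n => F (map_tuple s t0)).
Proof.
move=> t0_uniq.
have q_le : (q <= n)%N.
  by rewrite -(card_uniq_tuple t0_uniq) -[leqRHS]card_ord max_card.
have orbit (t : q.-tuple 'I_n) : uniq t ->
    avg (fun s : 'S_n => F (map_tuple s t)) =
    avg (fun s : 'S_n => F (map_tuple s t0)).
  move=> t_uniq.
  have [r rE] := perm_extend (tuple_uniqP _ t0_uniq) (tuple_uniqP _ t_uniq).
  rewrite [RHS](avg_reindex _ (mulgI r)); apply: eq_avg => s /=; congr F.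
  by apply: eq_from_tnth => i; rewrite !tnth_map permM rE.
have sumE : \sum_(t : q.-tuple 'I_n | uniq t) F t =
    (n ^_ q)%:R * avg (fun s : 'S_n => F (map_tuple s t0)).
  have -> : (n ^_ q)%:R * avg (fun s : 'S_n => F (map_tuple s t0)) =
      \sum_(t : q.-tuple 'I_n | uniq t) avg (fun s : 'S_n => F (map_tuple s t)).
    rewrite (eq_bigr _ orbit) sumr_const mulr_natl; congr (_ *+ _).
    have := card_uniq_tuples q (predT : pred 'I_n); rewrite card_ord => <-.
    by apply: eq_card => t; rewrite !inE all_predT.
  have card_gt0 : (0 < #|{: 'S_n}|)%N by rewrite card_Sn fact_gt0.
  rewrite -[LHS](avg_cst _ card_gt0) /avg -mulr_suml [in RHS]exchange_big/=.
  congr (_ / _); apply: eq_bigr => s _.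
  have map_inj : injective (fun t : q.-tuple 'I_n => map_tuple s t).
    by move=> t t' /(congr1 val)/(inj_map perm_inj) /val_inj.
  rewrite (reindex_inj map_inj); apply: eq_bigl => t /=.
  by rewrite map_inj_uniq//; exact: perm_inj.
by rewrite sumE mulrA [X in X * _]mulrAC -natrM mulnC ffact_fact// divff ?mul1r.
Qed.

(** The form needed for the sums that define the statistic, whose index tuples
   come in two parts; [e] glues the parts together. *)
Lemma avg_perm_pair (R : realType) (I J : finType) (n q : nat)
    (e : I * J -> q.-tuple 'I_n) (t0 : q.-tuple 'I_n)
    (F : q.-tuple 'I_n -> R) : injective e -> (n ^ q <= #|I| * #|J|)%N ->
  uniq t0 ->
  ((n - q)`!)%:R / (n`!)%:R *
    (\sum_(i : I) \sum_(j : J | uniq (e (i, j))) F (e (i, j))) =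
  avg (fun s : 'S_n => F (map_tuple s t0)).
Proof.
move=> e_inj card_le t0_uniq; rewrite -avg_perm_tuple//; congr (_ * _).
rewrite pair_big_dep/= [RHS](reindex e)/=; first by apply: eq_big => [] [].
by apply/onW_bij/inj_card_bij; rewrite // card_tuple card_ord card_prod.
Qed.

(** * The degenerate kernel on blocks *)

Section BlockKernel.
Variables (R : realType) (d n : nat) (A : 'I_d -> 'I_n -> 'I_n -> R) (z : 'I_d).
Implicit Types x y : 'I_d -> 'I_d -> 'I_n.

Definition gram_prod (u v : 'I_d -> 'I_n) : R := \prod_l A l (u l) (v l).

(** The scalar product <psi(x), psi(y)>, where [x l r] is the data index that
   coordinate l sees in slot r of the block. *)
Definition block_kernel x y : R :=
  gram_prod (x^~ z) (y^~ z) + gram_prod (fun l => x l l) (fun l => y l l)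
  - gram_prod (x^~ z) (fun l => y l l) - gram_prod (fun l => x l l) (y^~ z).

Definition shuffle (g : {ffun 'I_d -> 'S_d}) x : 'I_d -> 'I_d -> 'I_n :=
  fun l r => x l (g l r).

(** The coordinates are shuffled independently, and a random permutation sends
   any slot to a uniform slot; so it does not matter which slot each coordinate
   reads. *)
Lemma avg_shuffle x (v : 'I_d -> 'I_n) (r : 'I_d -> 'I_d) :
  avg (fun g => gram_prod (fun l => shuffle g x l (r l)) v) =
  avg (fun g => gram_prod (fun l => shuffle g x l z) v).
Proof.
rewrite /gram_prod /shuffle.
rewrite (avg_prod (fun l (s : 'S_d) => A l (x l (s (r l))) (v l))).
rewrite (avg_prod (fun l (s : 'S_d) => A l (x l (s z)) (v l))).
apply: eq_bigr => l _; rewrite (avg_reindex _ (mulgI (tperm z (r l)))).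
by apply: eq_avg => s /=; rewrite permM tpermR.
Qed.

Lemma block_kernel_centered x y :
  avg (fun g => block_kernel (shuffle g x) y) = 0.
Proof.
rewrite /block_kernel !avgB avgD.
have /= -> := avg_shuffle x (y^~ z) id.
have /= -> := avg_shuffle x (fun l => y l l) id.
by ring.
Qed.

Lemma block_kernelC x y : (forall l i j, A l i j = A l j i) ->
  block_kernel x y = block_kernel y x.
Proof.
move=> A_sym; rewrite /block_kernel -!addrA; congr (_ + (_ + _)).
- by apply: eq_bigr.
- by apply: eq_bigr.
by rewrite addrC; congr (- _ - _); apply: eq_bigr.
Qed.

Lemma block_kernel_bound x y (K : 'I_d -> R) :
  (forall l i j, 0 <= A l i j <= K l) ->
  `|block_kernel x y| <= 2 * \prod_l K l.
Proof.
move=> AK; have bound u v : 0 <= gram_prod u v <= \prod_l K l.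
  apply/andP; split; last exact: ler_prod.
  by apply: prodr_ge0 => l _; case/andP: (AK l (u l) (v l)).
rewrite /block_kernel ler_norml.
have := bound (x^~ z) (y^~ z); have := bound (fun l => x l l) (fun l => y l l).
have := bound (x^~ z) (fun l => y l l); have := bound (fun l => x l l) (y^~ z).
by do 4!move=> /andP[? ?]; apply/andP; split; lra.
Qed.

End BlockKernel.

(** * The moment generating function of the permuted statistic *)

Section Statistic.
Variables (R : realType) (d n : nat) (T : 'I_d -> ptopologicalType).
Variables (k : forall l, T l -> T l -> R) (X : 'I_n -> forall l, T l).
Variable z : 'I_d.
Hypothesis k_sym : forall l (x y : T l), k x y = k y x.

Let A (l : 'I_d) (i j : 'I_n) : R := k (X i l) (X j l).
Let Asym l i j : A l i j = A l j i. Proof. exact: k_sym. Qed.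

(** The four terms of [block_kernel] average to the three sums of the statistic;
   the two mixed terms both give the third one, by symmetry of the kernels. *)
Lemma U_dHSIC_avg (p q : 'I_d -> 'I_n) (pi : {ffun 'I_d -> 'S_n}) :
  uniq (mktuple p ++ mktuple q) ->
  U_dHSIC k X pi = avg (fun s : 'S_n => block_kernel A z
    (fun l r => pi l (s (p r))) (fun l r => pi l (s (q r)))).
Proof.
rewrite cat_uniq => /and3P[p_uniq pq_disj q_uniq].
have pq_uniq : uniq (mktuple p ++ mktuple q) by rewrite cat_uniq p_uniq pq_disj.
have pzq : p z \notin mktuple q.
  apply: contra pq_disj => pz; apply/hasP; exists (p z) => //.
  by rewrite -(tnth_mktuple p) mem_tnth.
have qzp : q z \notin mktuple p.
  apply: contra pq_disj => qz; apply/hasP; exists (q z) => //.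
  by rewrite -(tnth_mktuple q) mem_tnth.
have pzq_uniq : uniq (p z :: mktuple q) by rewrite cons_uniq pzq q_uniq.
have qzp_uniq : uniq (q z :: mktuple p) by rewrite cons_uniq qzp p_uniq.
have cross (u v : 'I_d -> 'I_n) :
    uniq (u z :: mktuple v) ->
    ((n - d - 1)`!)%:R / (n`!)%:R *
      (\sum_(i < n) \sum_(j : d.-tuple 'I_n | uniq (i :: j))
         \prod_(l < d) permuted_gram k X pi l i (tnth j l)) =
    avg (fun s : 'S_n =>
      gram_prod A (fun l => pi l (s (u z))) (fun l => pi l (s (v l)))).
  move=> uv_uniq; rewrite -subnDA addn1.
  pose e (ij : 'I_n * d.-tuple 'I_n) := cons_tuple ij.1 ij.2.
  pose F (t : d.+1.-tuple 'I_n) :=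
    \prod_(l < d) A l (pi l (tnth t ord0)) (pi l (tnth t (lift ord0 l))).
  have e_inj : injective e.
    by move=> [i j] [i' j'] /(congr1 val)[-> /val_inj->].
  have e_card : (n ^ d.+1 <= #|{: 'I_n}| * #|{: d.-tuple 'I_n}|)%N.
    by rewrite card_tuple card_ord expnS.
  have := @avg_perm_pair R _ _ n d.+1 e (e (u z, mktuple v)) F
    e_inj e_card uv_uniq.
  rewrite /F /= => E; apply: etrans (etrans _ E) _.
    congr (_ * _); apply: eq_bigr => i _; apply: eq_bigr => j _.
    by apply: eq_bigr => l _; rewrite tnthS.
  apply: eq_avg => s; apply: eq_bigr => l _.
  by rewrite !tnth_map /= tnthS tnth_mktuple.
have first : ((n - 2)`!)%:R / (n`!)%:R *
    (\sum_(i < n) \sum_(j < n | uniq [:: i; j])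
       \prod_(l < d) permuted_gram k X pi l i j) =
    avg (fun s : 'S_n =>
      gram_prod A (fun l => pi l (s (p z))) (fun l => pi l (s (q z)))).
  pose e (ij : 'I_n * 'I_n) := [tuple ij.1; ij.2].
  pose F (t : 2.-tuple 'I_n) :=
    \prod_(l < d) A l (pi l (tnth t ord0)) (pi l (tnth t ord_max)).
  have e_inj : injective e by move=> [i j] [i' j'] /(congr1 val)[-> ->].
  have e_card : (n ^ 2 <= #|{: 'I_n}| * #|{: 'I_n}|)%N by rewrite card_ord.
  have e_uniq : uniq (e (p z, q z)).
    rewrite /= andbT inE; apply: contra pzq => /eqP->.
    by rewrite -(tnth_mktuple q) mem_tnth.
  have := @avg_perm_pair R _ _ n 2 e (e (p z, q z)) F e_inj e_card e_uniq.
  rewrite /F /= => E; exact: E.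
have second : ((n - 2 * d)`!)%:R / (n`!)%:R *
    (\sum_(i : d.-tuple 'I_n) \sum_(j : d.-tuple 'I_n | uniq (i ++ j))
       \prod_(l < d) permuted_gram k X pi l (tnth i l) (tnth j l)) =
    avg (fun s : 'S_n =>
      gram_prod A (fun l => pi l (s (p l))) (fun l => pi l (s (q l)))).
  rewrite mul2n -addnn.
  pose e (ij : d.-tuple 'I_n * d.-tuple 'I_n) := cat_tuple ij.1 ij.2.
  pose F (t : (d + d).-tuple 'I_n) :=
    \prod_(l < d) A l (pi l (tnth t (lshift d l))) (pi l (tnth t (rshift d l))).
  have e_inj : injective e.
    move=> [i j] [i' j'] /(congr1 val)/= /eqP.
    by rewrite eqseq_cat ?size_tuple// => /andP[/eqP/val_inj-> /eqP/val_inj->].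
  have e_card : (n ^ (d + d) <= #|{: d.-tuple 'I_n}| * #|{: d.-tuple 'I_n}|)%N.
    by rewrite card_tuple card_ord expnD.
  have := @avg_perm_pair R _ _ n (d + d) e (e (mktuple p, mktuple q)) F
    e_inj e_card pq_uniq.
  rewrite /F /= => E; apply: etrans (etrans _ E) _.
    congr (_ * _); apply: eq_bigr => i _; apply: eq_bigr => j _.
    by apply: eq_bigr => l _; rewrite tnth_lshift tnth_rshift.
  apply: eq_avg => s; apply: eq_bigr => l _.
  by rewrite !tnth_map /= tnth_lshift tnth_rshift !tnth_mktuple.
rewrite /block_kernel !avgB avgD /U_dHSIC first second.
have <- := cross p q pzq_uniq.
have -> : avg (fun s : 'S_n =>
      gram_prod A (fun l => pi l (s (p l))) (fun l => pi l (s (q z)))) =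
    avg (fun s : 'S_n =>
      gram_prod A (fun l => pi l (s (q z))) (fun l => pi l (s (p l)))).
  by apply: eq_avg => s; apply: eq_bigr.
by rewrite -(cross q p qzp_uniq) natrM; ring.
Qed.

(** The law of the values of pi at the positions [p y] is unchanged by
   rearranging the positions, separately in each coordinate: a rearrangement
   extends to a permutation of all positions, and composition with it is a
   bijection. *)
Lemma avg_slots (Q : finType) (p : Q -> 'I_n) (w : 'I_d -> Q -> Q)
    (F : ('I_d -> Q -> 'I_n) -> R) :
  injective p -> (forall l, injective (w l)) ->
  avg (fun pi : {ffun 'I_d -> 'S_n} => F (fun l y => pi l (p y))) =
  avg (fun pi : {ffun 'I_d -> 'S_n} => F (fun l y => pi l (p (w l y)))).
Proof.
move=> p_inj w_inj.
have /fin_all_exists[r rE] l : exists s : 'S_n, forall y, s (p y) = p (w l y).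
  exact: perm_extend p_inj (inj_comp p_inj (w_inj l)).
pose h (pi : {ffun 'I_d -> 'S_n}) := [ffun l => (r l * pi l)%g].
have h_inj : injective h.
  move=> pi pi' /ffunP e; apply/ffunP => l; apply: (mulgI (r l)).
  by have := e l; rewrite !ffunE.
rewrite (avg_reindex _ h_inj); apply: eq_avg => pi /=; congr F.
by apply/funext => l; apply/funext => y; rewrite ffunE permM rE.
Qed.

Lemma mgf_U_dHSIC (K : 'I_d -> R) (m : nat) (u : R) :
  (forall l (x y : T l), 0 <= k x y <= K l) ->
  (0 < m)%N -> (2 * m * d <= n)%N ->
  32 * (u * (2 * \prod_l K l) / m%:R) ^+ 2 <= 1 ->
  avg (fun pi : {ffun 'I_d -> 'S_n} => expR (u * U_dHSIC k X pi)) <=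
  expR (4 * (u * (2 * \prod_l K l) / m%:R) ^+ 2).
Proof.
move=> kK m_gt0 mdn small.
have mR_gt0 : 0 < m%:R :> R by rewrite ltr0n.
have [p p_inj] : exists p : bool * 'I_m * 'I_d -> 'I_n, injective p.
  have card_le : (#|{: bool * 'I_m * 'I_d}| <= n)%N.
    by rewrite !card_prod card_bool !card_ord.
  exists (widen_ord card_le \o enum_rank).
  by move=> x y /(congr1 val)/= /val_inj/enum_rank_inj.
(* The first component of a position tells the left blocks from the right
   ones, so that no position is shared and the chaos is decoupled. *)
pose W (v : 'I_d -> bool * 'I_m * 'I_d -> 'I_n) :=
  \sum_(a < m) \sum_(b < m) block_kernel A z
    (fun l r => v l (true, a, r)) (fun l r => v l (false, b, r)).
pose comp (pi : {ffun 'I_d -> 'S_n}) (s : 'S_n) := [ffun l => (s * pi l)%g].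
have UW pi : U_dHSIC k X pi =
    avg (fun s => (m%:R ^+ 2)^-1 * W (fun l y => comp pi s l (p y))).
  rewrite avgZ /W avg_sum; under eq_bigr do rewrite avg_sum.
  have Uab (a b : 'I_m) : avg (fun s => block_kernel A z
      (fun l r => comp pi s l (p (true, a, r)))
      (fun l r => comp pi s l (p (false, b, r)))) = U_dHSIC k X pi.
    rewrite (@U_dHSIC_avg (fun r => p (true, a, r)) (fun r => p (false, b, r))).
      apply: eq_avg => s; congr (block_kernel A z _ _);
        by apply/funext => l; apply/funext => r; rewrite ffunE permM.
    have map_uniq b' c : uniq [tuple p (b', c, r) | r < d].
      by rewrite map_inj_uniq ?enum_uniq// => r r' /p_inj[].
    rewrite cat_uniq !map_uniq andbT/=; apply/hasPn => _ /mapP[r _ ->].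
    by apply/negP => /mapP[r' _ /p_inj].
  under eq_bigr do under eq_bigr do rewrite Uab.
  rewrite !sumr_const card_ord -[U_dHSIC _ _ _ *+ m]mulr_natl.
  by rewrite -[(_ * _) *+ m]mulr_natl; field; lra.
have pi_gt0 : (0 < #|{: 'S_n}|)%N by rewrite card_Sn fact_gt0.
have Pi_gt0 : (0 < #|{: {ffun 'I_d -> 'S_n}}|)%N.
  by rewrite card_ffun expn_gt0 pi_gt0.
set c := 2 * \prod_l K l in small *.
pose v := u / m%:R ^+ 2.
apply: (@le_trans _ _ (avg (fun pi : {ffun 'I_d -> 'S_n} =>
    expR (v * W (fun l y => pi l (p y)))))).
  apply: (@le_trans _ _ (avg (fun pi => avg (fun s =>
      expR (v * W (fun l y => comp pi s l (p y))))))).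
    apply: le_avg => pi; rewrite UW -avgZ.
    by under eq_avg do rewrite mulrA; exact: expR_avg_le.
  rewrite exchange_avg -[leRHS](avg_cst _ pi_gt0); apply: le_avg => s.
  have comp_inj : injective (comp^~ s).
    move=> pi pi' /ffunP e; apply/ffunP => l; apply: (mulgI s).
    by have := e l; rewrite !ffunE.
  by rewrite [leRHS](avg_reindex _ comp_inj).
(* The shuffles: one permutation of the slots for each coordinate of a block. *)
pose S := {ffun 'I_d -> 'S_d}.
have S_gt0 : (0 < #|{: S}|)%N by rewrite card_ffun card_Sn expn_gt0 fact_gt0.
have mS_gt0 : (0 < #|{: {ffun 'I_m -> S}}|)%N.
  by rewrite card_ffun expn_gt0 S_gt0.
pose w (g g' : {ffun 'I_m -> S}) (l : 'I_d) (y : bool * 'I_m * 'I_d) :=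
  (y.1, (if y.1.1 then g else g') y.1.2 l y.2).
have w_inj g g' l : injective (w g g' l).
  by move=> [ba r] [ba' r'] [-> /perm_inj->].
rewrite -[leLHS](avg_cst _ mS_gt0).
under eq_avg => g do rewrite -[avg _](avg_cst _ mS_gt0).
under eq_avg => g do under eq_avg => g' do
  rewrite (avg_slots (fun f => expR (v * W f)) p_inj (w_inj g g')).
under eq_avg do rewrite exchange_avg.
rewrite exchange_avg -[leRHS](avg_cst _ Pi_gt0); apply: le_avg => pi.
pose blk b a l r := pi l (p (b, a, r)).
pose h (a b : 'I_m) (g g' : S) :=
  block_kernel A z (shuffle g (blk true a)) (shuffle g' (blk false b)).
have vc : v * c * #|'I_m|%:R = u * c / m%:R.
  by rewrite card_ord /v; field; lra.
rewrite -vc in small *.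
apply: (@mgf_decoupled_chaos R 'I_m S S h) => //; first by rewrite card_ord.
- by move=> a b g'; exact: block_kernel_centered.
- move=> a b g; under eq_avg do rewrite /h block_kernelC//.
  exact: block_kernel_centered.
- by move=> a b g g'; apply: block_kernel_bound => l i j; apply: kK.
Qed.

End Statistic.

(** * The tail bound *)

Lemma perm_prob_le_avg (R : realType) (d n : nat)
    (E : {ffun 'I_d -> 'S_n} -> bool) (f : {ffun 'I_d -> 'S_n} -> R) :
  (forall pi, 0 <= f pi) -> (forall pi, E pi -> 1 <= f pi) ->
  perm_prob R E <= avg f.
Proof.
move=> f_ge0 f_ge1; rewrite /perm_prob /avg ler_wpM2r ?invr_ge0//.
rewrite -sum1_card natr_sum [leLHS]big_mkcond/=; apply: ler_sum => pi _.
by rewrite inE; case: ifP => [/f_ge1|_]; [|exact: f_ge0].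
Qed.

Unset Implicit Arguments.

Theorem lemmaF6 (R : realType) (d : nat) (hd : (2 <= d)%N) :
  exists C : R, 0 < C /\
  forall (T : 'I_d -> ptopologicalType) (k : forall l, T l -> T l -> R)
         (K : 'I_d -> R),
    (forall l, separable_space (T l)) ->
    (forall l, continuous_kernel (k l)) ->
    (forall l, bounded_kernel (k l)) ->
    (forall l, psd_kernel (k l)) ->
    characteristic_kernel (product_kernel k) ->
    (forall l (x x' : T l), 0 <= k l x x' <= K l) ->
    let K0 := \prod_(l < d) K l in
    forall (n : nat) (X : 'I_n -> forall l, T l) (t : R),
      (2 * d <= n)%N -> 0 < t ->
      perm_prob R (fun pi : {ffun 'I_d -> 'S_n} => t <= U_dHSIC k X pi)
      <= expR (- (C * Num.min ((n%:R ^+ 2 * t ^+ 2) / K0 ^+ 2)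
                              ((n%:R * t) / K0))).
Proof.
(* With m blocks on each side, 4 n <= r m; this is where C depends on d. *)
pose r : R := 16 * d%:R.
have r_ge2 : 2 <= r by rewrite /r -natrM ler_nat (leq_trans hd)// leq_pmull.
have r_gt0 : 0 < r by apply: lt_le_trans r_ge2.
exists (4 * r ^+ 2)^-1; split; first by rewrite invr_gt0 mulr_gt0// exprn_gt0.
move=> T k K _ _ _ k_psd _ kK K0 n X t dn t_gt0.
have Pi_gt0 : (0 < #|{: {ffun 'I_d -> 'S_n}}|)%N.
  by rewrite card_ffun expn_gt0 card_Sn fact_gt0.
have K0_ge0 : 0 <= K0.
  apply: prodr_ge0 => l _; have /andP[k0] := kK l point point.
  exact: le_trans.
have [K0_0|K0_neq0] := eqVneq K0 0.
  (* Division by zero gives 0, so the right-hand side is exp 0 = 1. *)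
  rewrite K0_0 expr0n invr0 !mulr0 minxx mulr0 oppr0 expR0.
  rewrite -[leRHS](avg_cst 1 Pi_gt0).
  by apply: perm_prob_le_avg => pi; rewrite ?ler01.
have K0_gt0 : 0 < K0 by rewrite lt_def K0_neq0.
have d_gt0 : (0 < d)%N by apply: leq_trans hd.
pose m := (n %/ (2 * d))%N.
have m_gt0 : (0 < m)%N by rewrite divn_gt0 ?muln_gt0.
have mdn : (2 * m * d <= n)%N by rewrite mulnAC mulnC leq_trunc_div.
have n_le : 4 * n%:R <= r * m%:R.
  have : (n <= 4 * d * m)%N.
    have -> : (4 * d * m = 2 * m * (2 * d))%N.
      by rewrite mulnACA [(m * d)%N]mulnC mulnA.
    have d2_gt0 : (0 < 2 * d)%N by rewrite muln_gt0.
    apply: leq_trans (ltnW (ltn_ceil n d2_gt0)) _.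
    by apply: leq_mul => //; rewrite -/m mul2n -addnn -[m.+1]addn1 leq_add2l.
  rewrite -(ler_nat R) !natrM /r => n_le; clearbody m; clear -n_le.
  by lra.
have mR : 0 < m%:R :> R by rewrite ltr0n.
have nR : 0 < n%:R :> R by rewrite ltr0n (leq_trans _ dn)// muln_gt0.
pose x := n%:R * t / K0.
have x_gt0 : 0 < x by rewrite !mulr_gt0 ?invr_gt0.
have -> : n%:R ^+ 2 * t ^+ 2 / K0 ^+ 2 = x ^+ 2 by rewrite /x; field.
(* In the normalised deviation x the rate is min (x^2, x) = x * s. *)
rewrite -/x; pose s := Num.min x 1.
have s_gt0 : 0 < s by rewrite lt_min x_gt0 ltr01.
have s_le1 : s <= 1 by rewrite ge_min lexx orbT.
have s_lex : s <= x by rewrite ge_min lexx.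
have -> : Num.min (x ^+ 2) x = x * s.
  by rewrite /s minr_pMr ?mulr1 ?expr2// ltW.
clearbody r.
pose e := s / (4 * r).
have eE : e * (4 * r) = s by rewrite /e mulfVK// lt0r_neq0// mulr_gt0.
have e_gt0 : 0 < e by apply: divr_gt0 => //; apply: mulr_gt0.
clearbody e.
(* The Chernoff parameter: proportional to x where the rate is quadratic, and
   capped where it is linear, to stay in the range of the MGF bound. *)
pose u := 2 * e * n%:R / (r * K0).
have u_gt0 : 0 < u.
  by apply: divr_gt0; do ?apply: mulr_gt0.
pose v := u * (2 * K0) / m%:R.
have v_ge0 : 0 <= v.
  by apply/ltW/divr_gt0 => //; apply: mulr_gt0 => //; apply: mulr_gt0.
have v_le : v <= e.
  have -> : v = e * (4 * n%:R / (r * m%:R)).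
    by rewrite /v /u; field; rewrite K0_neq0 !lt0r_neq0.
  by rewrite ler_piMr ?(ltW e_gt0)// ler_pdivrMr ?mul1r// mulr_gt0.
have v2_le : v ^+ 2 <= e ^+ 2 by rewrite ler_sqr ?nnegrE// ltW.
have e_le : 8 * e <= 1 by clear -e_gt0 eE s_le1 r_ge2; nra.
have small : 32 * v ^+ 2 <= 1 by clear -v2_le e_le e_gt0; nra.
have mgf := mgf_U_dHSIC X (Ordinal d_gt0) (fun l => (k_psd l).1) kK
  m_gt0 mdn small.
apply: (@le_trans _ _ (avg (fun pi : {ffun 'I_d -> 'S_n} =>
    expR (- (u * t)) * expR (u * U_dHSIC k X pi)))).
  apply: perm_prob_le_avg => pi; first by rewrite mulr_ge0 ?expR_ge0.
  move=> t_le; rewrite -expRD -[leLHS]expR0 ler_expR addrC subr_ge0.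
  by rewrite ler_pM2l.
rewrite avgZ; apply: le_trans (ler_wpM2l (expR_ge0 _) mgf) _.
rewrite -expRD ler_expR -/K0 -/v.
have r_neq0 : r != 0 by rewrite lt0r_neq0.
have -> : u * t = 2 * (e * x / r) by rewrite /u /x; field; apply/andP.
have -> : (4 * r ^+ 2)^-1 * (x * s) = e * x / r by rewrite -eE; field.
suff : 4 * e ^+ 2 <= e * x / r by clear -v2_le; lra.
rewrite ler_pdivlMr//.
have : e * s <= e * x by rewrite ler_pM2l.
by rewrite -eE; clear; lra.
Qed.
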